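(* Let $n\geq 1$, let $S_0=\{i\in\mathbb{Z}^n:i_1,\ldots,i_n\geq 0\}$, and let $(a_i)_{i\in S_0}$ be an indexed collection of nonnegative real numbers such that $a_0=1$ and $a_{i+j}\leq a_ia_j$ for all $i,j\in S_0$. Then there exist elements $x_1,\ldots,x_n$ in some commutative Banach algebra such that $\lVert x_1^{i_1}\cdots x_n^{i_n}\rVert=a_i$ for all $i\in S_0$ and $$\sigma(x_1,\ldots,x_n)=\{s\in\mathbb{C}^n:|s_1^{i_1}\cdots s_n^{i_n}|\leq a_i\text{ for all }i\in S_0\}.$$
   Context: Banach algebras are complex and unital, with submultiplicative norm and $\lVert 1\rVert=1$. For elements $x_1,\ldots,x_n$ of a commutative Banach algebra $A$, the joint spectrum is $\sigma(x_1,\ldots,x_n)=\{(\phi(x_1),\ldots,\phi(x_n)):\phi\in\mathcal{M}_A\}\subset\mathbb{C}^n$, where $\mathcal{M}_A$ is the set of nonzero multiplicative linear functionals $A\to\mathbb{C}$. Convention: $0^0=1$. *)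

(* Defs.v *)
From HB Require Import structures.
From mathcomp Require Import all_boot all_order all_algebra.
From mathcomp Require Import all_classical all_reals all_analysis.
From mathcomp Require Export complex.
Import numFieldNormedType.Exports.

Set Implicit Arguments.
Unset Strict Implicit.
Unset Printing Implicit Defensive.

Import Order.TTheory GRing.Theory Num.Theory.
Local Open Scope classical_set_scope.
Local Open Scope ring_scope.

(* Hierarchy Builder rejects a new join of ring and normed structures, because
   Num.NumDomain already inherits from both. So the multiplication is a field
   here, and the library's ring and algebra structures are derived below.
   Normed modules over K have K-valued norms; for K = R[i] the order on K is
   the partial order for which x <= y means that y - x is a nonnegative real. *)
HB.mixin Record CompleteNormedModule_isComBanachAlgebra (K : numFieldType) A
    of CompleteNormedModule K A := {
  banach_one : A ;
  banach_mul : A -> A -> A ;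
  banach_mulA : associative banach_mul ;
  banach_mulC : commutative banach_mul ;
  banach_mul1 : left_id banach_one banach_mul ;
  banach_mulDl : left_distributive banach_mul +%R ;
  banach_scaleAl : forall (k : K) (x y : A),
    k *: banach_mul x y = banach_mul (k *: x) y ;
  banach_norm_submul : forall x y : A, `|banach_mul x y| <= `|x| * `|y| ;
  banach_norm_one : `|banach_one| = 1
}.

#[short(type="comBanachAlgType")]
HB.structure Definition ComBanachAlgebra (K : numFieldType) :=
  {A of CompleteNormedModule K A
      & CompleteNormedModule_isComBanachAlgebra K A}.

Section ComBanachAlgebraInstances.
Variables (K : numFieldType) (A : comBanachAlgType K).

Lemma banach_one_neq0 : banach_one != 0 :> A.
Proof. by rewrite -normr_gt0 banach_norm_one ltr01. Qed.

HB.instance Definition _ := GRing.Zmodule_isComNzRing.Build A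
  banach_mulA banach_mulC banach_mul1 banach_mulDl banach_one_neq0.

HB.instance Definition _ := GRing.Lmodule_isLalgebra.Build K A banach_scaleAl.

HB.instance Definition _ := GRing.Lalgebra_isComAlgebra.Build K A.

Lemma banach_normM (x y : A) : `|x * y| <= `|x| * `|y|.
Proof. exact: banach_norm_submul. Qed.

Lemma banach_norm1 : `|1 : A| = 1.
Proof. exact: banach_norm_one. Qed.

End ComBanachAlgebraInstances.

(* No continuity is required of the functionals. *)
Definition characters (K : numFieldType) (A : comBanachAlgType K) :
    set {scalar A} :=
  [set phi : {scalar A} |
    {morph phi : x y / x * y} /\ exists x : A, phi x != 0].
Arguments characters {K} A.

Definition joint_spectrum (K : numFieldType) (A : comBanachAlgType K) (n : nat)
    (x : 'I_n -> A) : set 'rV[K]_n :=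
  [set \row_k phi (x k) | phi in characters A].

(* Main.v *)
From HB Require Import structures.
Require Import Defs.
From mathcomp Require Import finmap.
From mathcomp Require Import all_boot all_order all_algebra.
From mathcomp Require Import all_classical all_reals all_analysis.
From mathcomp Require Import summability.
Import numFieldNormedType.Exports.
Import Order.TTheory GRing.Theory Num.Theory.
Local Open Scope classical_set_scope.
Local Open Scope ring_scope.
Local Open Scope complex_scope.

Set Implicit Arguments.
Unset Strict Implicit.
Unset Printing Implicit Defensive.

(**
  The algebra is a weighted l^1 space.  Let S be the additive monoid of
  multi-indices and w = a the given submultiplicative weight.  The elements of
  [l1 w] are the families f : S -> C with sum_s |f_s| w_s finite, normed by that
  sum; they multiply by convolution, which is submultiplicative because w is.
  Where w vanishes, the would-be norm is only a seminorm; since the zero set of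
  w is an ideal of S, one may divide by it, and this is done by requiring f to
  vanish there.  The generators are the unit masses at the coordinate
  multi-indices, so that the monomial of exponent i is the unit mass at i, of
  norm a_i.

  Everything about this algebra follows from the universal property of [l1 w]:
  a family v of vectors of a Banach space V with |v_s| <= C w_s extends, by
  f |-> sum_s f_s v_s ([ext]), to a linear map l1 w -> V of norm at most C, and
  a bounded linear map is determined by its values on the unit masses
  ([bdlinear_ext_eq]).  Existence gives the convolution (extend s, t |-> unit
  mass at s + t in each variable) together with its norm bound, and uniqueness
  reduces commutativity, associativity and the unit law to those of S.  No sum
  over the decompositions s = t + u is ever written.

  For the spectrum, let s be a point with |s^i| <= a_i for every i.  Then
  i |-> s^i extends to a bounded functional, multiplicative because it is so on
  unit masses; hence s is in the spectrum ([exists_character]).  Conversely, a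
  character phi of any commutative Banach algebra satisfies |phi x| <= |x|
  ([character_contractive]); applied to the monomials, this is the family of
  inequalities |s^i| <= a_i.
*)

(** * Real-valued norms over the complex numbers *)

#[local] Existing Instance totally_filter.

Section real_valued_norm.
Variable R : realType.

(** Norms over [R[i]] take values in [R[i]], whose order is only partial.
    Estimates, suprema and limits are carried out on this real version. *)
Definition rnorm (V : normedZmodType R[i]) (x : V) : R := complex.Re `|x|.

Section normed_zmodule.
Variable V : normedZmodType R[i].
Implicit Types x y : V.

Lemma normr_rnorm x : `|x| = (rnorm x)%:C.
Proof. by rewrite /rnorm RRe_real// normr_real. Qed.

Lemma rnorm_uniq x (r : R) : `|x| = r%:C -> rnorm x = r.
Proof. by rewrite /rnorm => ->. Qed.

Lemma rnorm_ge0 x : 0 <= rnorm x.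
Proof. by rewrite -ler0c -normr_rnorm. Qed.

Lemma rnorm0 : rnorm (0 : V) = 0.
Proof. by apply: rnorm_uniq; rewrite normr0. Qed.

Lemma rnorm0_eq0 x : rnorm x = 0 -> x = 0.
Proof. by move=> x0; apply/eqP; rewrite -normr_eq0 normr_rnorm x0. Qed.

Lemma rnormN x : rnorm (- x) = rnorm x.
Proof. by rewrite /rnorm normrN. Qed.

Lemma rnormB x y : rnorm (x - y) = rnorm (y - x).
Proof. by rewrite /rnorm distrC. Qed.

Lemma ler_rnormD x y : rnorm (x + y) <= rnorm x + rnorm y.
Proof. by rewrite -lecR rmorphD/= -!normr_rnorm ler_normD. Qed.

Lemma ler_rnormB x y z : rnorm (x - y) <= rnorm (x - z) + rnorm (z - y).
Proof. by rewrite -[x - y](subrKA z) ler_rnormD. Qed.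

Lemma ler_rnorm_sum (I : Type) (r : seq I) (F : I -> V) :
  rnorm (\sum_(i <- r) F i) <= \sum_(i <- r) rnorm (F i).
Proof.
elim/big_rec2: _ => [|i y x _ le_xy]; first by rewrite rnorm0.
by rewrite (le_trans (ler_rnormD _ _))// lerD2l.
Qed.

End normed_zmodule.

Lemma rnormM (x y : R[i]) : rnorm (x * y) = rnorm x * rnorm y.
Proof. by apply: rnorm_uniq; rewrite normrM !normr_rnorm rmorphM. Qed.

Lemma rnorm1 : rnorm (1 : R[i]) = 1.
Proof. by apply: rnorm_uniq; rewrite normr1. Qed.

Lemma rnormZ (V : normedModType R[i]) (k : R[i]) (x : V) :
  rnorm (k *: x) = rnorm k * rnorm x.
Proof. by apply: rnorm_uniq; rewrite normrZ !normr_rnorm rmorphM. Qed.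

Lemma gt0_complexP (e : R[i]) : 0 < e -> exists2 r : R, 0 < r & e = r%:C.
Proof.
move=> e0; exists (complex.Re e); last by rewrite RRe_real// gtr0_real.
by rewrite -ltcR RRe_real// gtr0_real.
Qed.

Section convergence.
Variables (V : normedModType R[i]) (F : set_system V).

Lemma cvg_rnormP (FF : Filter F) (l : V) :
  F --> l <-> forall e : R, 0 < e -> \forall x \near F, rnorm (l - x) < e.
Proof.
split=> [/cvgrPdist_lt Fl e e0|Fl].
  have := Fl e%:C; rewrite ltcR => /(_ e0).
  by apply: filterS => x; rewrite normr_rnorm ltcR.
apply/cvgrPdist_lt => _ /gt0_complexP[e e0 ->].
by apply: filterS (Fl e e0) => x; rewrite normr_rnorm ltcR.
Qed.

Lemma cauchy_rnormP (FF : ProperFilter F) :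
  cauchy F <-> forall e : R, 0 < e -> exists x, F [set y | rnorm (x - y) < e].
Proof.
rewrite cauchyP; split=> Fc => [e e0|_ /gt0_complexP[e e0 ->]].
  have [|x Fx] := Fc e%:C; first by rewrite ltcR.
  exists x; apply: filterS Fx => y.
  by rewrite -ball_normE/= normr_rnorm ltcR.
have [x Fx] := Fc e e0; exists x; apply: filterS Fx => y.
by rewrite -ball_normE/= normr_rnorm ltcR.
Qed.

Lemma rnorm_limit_le {FF : ProperFilter F} (l : V) (r : R) : F --> l ->
  (\forall x \near F, rnorm x <= r) -> rnorm l <= r.
Proof.
move=> /cvg_rnormP Fl Fr; apply/ler_addgt0Pr => e e0.
have [x [lx xr]] := filter_ex (filterI (Fl e e0) Fr).
rewrite -[l](subrK x) addrC (le_trans (ler_rnormD _ _))//.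
by rewrite lerD// ltW.
Qed.

End convergence.

Lemma ler_Re_rnorm (z : R[i]) : `|complex.Re z| <= rnorm z.
Proof. by rewrite -lecR -normr_rnorm normc_ge_Re. Qed.

Lemma rnormi : rnorm ('i%C : R[i]) = 1.
Proof. by apply: rnorm_uniq; rewrite normc_def/= expr0n add0r expr1n sqrtr1. Qed.

Lemma ler_Im_rnorm (z : R[i]) : `|complex.Im z| <= rnorm z.
Proof.
by have := ler_Re_rnorm (z * 'i%C); rewrite ReiNIm normrN rnormM rnormi mulr1.
Qed.

Lemma ler_rnorm_ReIm (z : R[i]) :
  rnorm z <= `|complex.Re z| + `|complex.Im z|.
Proof.
have rnormR (r : R) : rnorm r%:C = `|r|.
  by apply: rnorm_uniq; rewrite normc_def/= expr0n addr0 sqrtr_sqr.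
rewrite {1}[z]complexE (le_trans (ler_rnormD _ _))//.
by rewrite rnormM rnormi mul1r !rnormR.
Qed.

End real_valued_norm.

(** The complex numbers as a normed module over themselves: together with their
    completeness, this makes them a Banach space in which functionals on [l1 w]
    can take their values. *)
HB.instance Definition _ (R : realType) := NormedModule.copy R[i] R[i]^o.

(** The real and imaginary parts are 1-Lipschitz, hence send a Cauchy filter to
    Cauchy filters of real numbers; their limits are the coordinates of the
    limit because [|z| <= |Re z| + |Im z|]. *)
Lemma complex_complete (R : realType) (F : set_system R[i]) :
  ProperFilter F -> cauchy F -> cvg F.
Proof.
move=> FF /cauchy_rnormP Fc; apply/cvg_ex.
have FcR (h : R[i] -> R) : {morph h : x y / x - y} ->
    (forall z, `|h z| <= rnorm z) -> cvg (h @ F).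
  move=> hB h_le; apply: R_complete; apply/cauchyP => e e0.
  have [x Fx] := Fc e e0; exists (h x); rewrite nbhs_simpl.
  apply: (@filterS _ F _ _ _ _ Fx) => y /= xy.
  by rewrite -ball_normE/= -hB (le_lt_trans (h_le _)).
have /cvg_ex[a /cvgrPdist_lt Fa] : cvg (@complex.Re R @ F).
  by apply: FcR (@ler_Re_rnorm R) => -[? ?] [? ?].
have /cvg_ex[b /cvgrPdist_lt Fb] : cvg (@complex.Im R @ F).
  by apply: FcR (@ler_Im_rnorm R) => -[? ?] [? ?].
exists (a +i* b); apply/cvg_rnormP => e e0; near=> z.
rewrite (le_lt_trans (ler_rnorm_ReIm _))// [e]splitr.
rewrite ltrD//.
  have -> : complex.Re (a +i* b - z) = a - complex.Re z by case: (z).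
  by near: z; apply: Fa; rewrite divr_gt0.
have -> : complex.Im (a +i* b - z) = b - complex.Im z by case: (z).
by near: z; apply: Fb; rewrite divr_gt0.
Unshelve. all: by end_near. Qed.

HB.instance Definition _ (R : realType) :=
  Uniform_isComplete.Build R[i] (@complex_complete R).

(** * Weighted l^1 spaces *)

Record weight (R : realType) (S : Type) := Weight {
  weight_fun :> S -> R ;
  weight_ge0 : forall s, 0 <= weight_fun s }.

Lemma big_fset_split (V : nmodType) (S : choiceType) (D E : {fset S})
    (F : S -> V) : (D `<=` E)%fset ->
  \sum_(s <- E) F s = \sum_(s <- D) F s + \sum_(s <- (E `\` D)%fset) F s.
Proof.
move=> /fsubsetP DE; rewrite (big_fsetID _ (mem D))/=; congr (_ + _).
  by apply: eq_fbigl => s; rewrite !inE/= andbC; apply: andb_idr => /DE.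
by apply: eq_fbigl => s; rewrite !inE/= andbC.
Qed.

Section weighted_sum.
Variables (R : realType) (S : choiceType) (w : weight R S).
Implicit Types (f g : S -> R[i]) (D E : {fset S}).

Definition wsum f D : R := \sum_(s <- D) rnorm (f s) * w s.

Lemma wsum_ge0 f D : 0 <= wsum f D.
Proof. by apply: sumr_ge0 => s _; rewrite mulr_ge0 ?rnorm_ge0 ?weight_ge0. Qed.

Lemma wsum_subset f D E : (D `<=` E)%fset -> wsum f D <= wsum f E.
Proof.
by move=> DE; rewrite /wsum (big_fset_split _ DE) lerDl; exact: wsum_ge0.
Qed.

Lemma wsum0 D : wsum 0 D = 0.
Proof. by rewrite /wsum big1// => s _; rewrite rnorm0 mul0r. Qed.

Lemma wsumZ k f D : wsum (k *: f) D = rnorm k * wsum f D.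
Proof. by rewrite mulr_sumr; apply: eq_bigr => s _; rewrite rnormM mulrA. Qed.

Lemma ler_wsumD f g D : wsum (f + g) D <= wsum f D + wsum g D.
Proof.
rewrite -big_split/=; apply: ler_sum => s _.
by rewrite -mulrDl ler_wpM2r ?weight_ge0// ler_rnormD.
Qed.

Lemma ler_wsumB f g h D : wsum (f - g) D <= wsum (f - h) D + wsum (h - g) D.
Proof. by rewrite -[f - g](subrKA h) ler_wsumD. Qed.

(** Vanishing where the weight does is what makes the seminorm
    [f |-> sum_s |f_s| w_s] definite: it picks one representative in each class
    modulo the families of seminorm zero. *)
Definition l1_pred : {pred S -> R[i]} := fun f =>
  `[< (forall s, w s = 0 -> f s = 0) /\ exists M, forall D, wsum f D <= M >].

Lemma l1_submod_closed : submod_closed l1_pred.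
Proof.
split; first by apply/asboolP; split=> //; exists 0 => D; rewrite wsum0.
move=> k f g /asboolP[f0 [M fM]] /asboolP[g0 [N gN]]; apply/asboolP; split.
  by move=> s ws; rewrite !fctE/= f0// g0// scaler0 addr0.
exists (rnorm k * M + N) => D; rewrite (le_trans (ler_wsumD _ _ _))//.
by rewrite lerD// wsumZ ler_wpM2l// rnorm_ge0.
Qed.

HB.instance Definition _ :=
  GRing.isSubmodClosed.Build R[i] (S -> R[i]) l1_pred l1_submod_closed.

Record l1 := L1 { l1_fun :> S -> R[i] ; l1_funP : l1_fun \in l1_pred }.

HB.instance Definition _ := [isSub for l1_fun].
HB.instance Definition _ := [Choice of l1 by <:].
HB.instance Definition _ := [SubChoice_isSubLmodule of l1 by <:].
End weighted_sum.

Section l1_norm.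
Variables (R : realType) (S : choiceType) (w : weight R S).
Implicit Types (f g : l1 w) (D E : {fset S}).

Definition l1norm f : R := sup (range (wsum w f)).

Lemma l1_eq0 f s : w s = 0 -> f s = 0.
Proof. by have /asboolP[f0 _] := l1_funP f; exact: f0. Qed.

Lemma wsum_has_sup f : has_sup (range (wsum w f)).
Proof.
have /asboolP[_ [M fM]] := l1_funP f.
by split; [exists (wsum w f fset0), fset0|exists M => _ [D _ <-]].
Qed.

Lemma ler_wsum_l1norm f D : wsum w f D <= l1norm f.
Proof. by apply: ub_le_sup; [case: (wsum_has_sup f)|exists D]. Qed.

Lemma l1norm_le f (M : R) : (forall D, wsum w f D <= M) -> l1norm f <= M.
Proof.
move=> fM; apply: ge_sup; first by case: (wsum_has_sup f).
by move=> _ [D _ <-].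
Qed.

Lemma l1norm_ge0 f : 0 <= l1norm f.
Proof. exact: le_trans (wsum_ge0 w f fset0) (ler_wsum_l1norm f fset0). Qed.

Lemma ler_coef_l1norm f s : rnorm (f s) * w s <= l1norm f.
Proof.
by rewrite (le_trans _ (ler_wsum_l1norm f [fset s]%fset))// /wsum big_seq_fset1.
Qed.

Lemma wsum_l1norm_approx f (e : R) : 0 < e ->
  exists D, l1norm f - e < wsum w f D.
Proof.
move=> e0; have [_ [D _ <-] ?] := sup_adherent e0 (wsum_has_sup f).
by exists D.
Qed.

Lemma ler_l1normD f g : l1norm (f + g) <= l1norm f + l1norm g.
Proof.
apply: l1norm_le => D; rewrite (le_trans (ler_wsumD _ _ _ _))//.
by rewrite lerD// ler_wsum_l1norm.
Qed.

Lemma l1normZ (k : R[i]) f : l1norm (k *: f) = rnorm k * l1norm f.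
Proof.
have le_l1normZ (c : R[i]) h : l1norm (c *: h) <= rnorm c * l1norm h.
  apply: l1norm_le => D; rewrite wsumZ ler_wpM2l ?rnorm_ge0//.
  exact: ler_wsum_l1norm.
apply/eqP; rewrite eq_le le_l1normZ/=.
have [->|k0] := eqVneq k 0; first by rewrite rnorm0 mul0r l1norm_ge0.
rewrite -{1}[f](scalerK k0).
rewrite (le_trans (ler_wpM2l (rnorm_ge0 k) (le_l1normZ _ _)))//.
by rewrite mulrA -rnormM divff// rnorm1 mul1r.
Qed.

Lemma l1norm_eq0 f : l1norm f = 0 -> f = 0.
Proof.
move=> f0; apply/val_inj/funext => s /=.
have [/l1_eq0 //|ws0] := eqVneq (w s) 0.
apply/rnorm0_eq0/eqP; have := ler_coef_l1norm f s.
rewrite f0 pmulr_lle0 ?lt_def ?ws0 ?weight_ge0// => fs0.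
by rewrite eq_le fs0 rnorm_ge0.
Qed.

Let l1normC f := (l1norm f)%:C.

Let ler_l1normCD f g : l1normC (f + g) <= l1normC f + l1normC g.
Proof. by rewrite -rmorphD lecR ler_l1normD. Qed.

Let l1normCZ (k : R[i]) f : l1normC (k *: f) = `|k| * l1normC f.
Proof. by rewrite normr_rnorm -rmorphM /l1normC l1normZ. Qed.

Let l1normC_eq0 f : l1normC f = 0 -> f = 0.
Proof. by move=> /complexI/l1norm_eq0. Qed.

HB.instance Definition _ := Lmodule_isNormed.Build R[i] (l1 w)
  ler_l1normCD l1normCZ l1normC_eq0.

Lemma rnorm_l1 f : rnorm f = l1norm f.
Proof. exact: rnorm_uniq. Qed.

(** A Cauchy filter converges coefficientwise, uniformly on finite sets of
    indices.  The distance of the pointwise limit to a center of a small ball of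
    the filter is therefore small over each finite set, hence in norm; this
    yields both summability of the limit and norm convergence to it. *)
Lemma l1_complete (F : set_system (l1 w)) :
  ProperFilter F -> cauchy F -> cvg F.
Proof.
move=> FF /cauchy_rnormP Fc; apply/cvg_ex.
(* where the weight is zero the coefficients are all 0, and so is the limit *)
have coef_cvg s : exists z : R[i],
    (w s = 0 -> z = 0) /\ (fun f : l1 w => f s) @ F --> z.
  have [ws0|ws0] := eqVneq (w s) 0.
    exists 0; split=> //; apply/cvg_rnormP => e e0.
    by apply: (@filterE _ F) => f /=; rewrite (l1_eq0 f ws0) subr0 rnorm0.
  have ws_gt0 : 0 < w s by rewrite lt_def ws0 weight_ge0.
  suff /cvg_ex[z Fz] : cvg ((fun f : l1 w => f s) @ F).
    by exists z; split=> // /eqP; rewrite (negbTE ws0).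
  apply: complex_complete; apply/cauchy_rnormP => e e0.
  have [|f Ff] := Fc (e * w s); first by rewrite mulr_gt0.
  exists (f s); rewrite nbhs_simpl.
  apply: (@filterS _ F _ _ _ _ Ff) => g /=; rewrite rnorm_l1 => fg.
  rewrite -(ltr_pM2r ws_gt0); apply: le_lt_trans fg.
  exact: (ler_coef_l1norm (f - g)).
have [g g_lim] := choice coef_cvg.
have wsum_cvg D e : 0 < e ->
    \forall f \near F, wsum w (g - l1_fun f) D < e.
  elim/fset1U_rect: D e => [|s D sD IH] e e0.
    by apply: filterE => f; rewrite /wsum big_seq_fset0.
  have e2 : 0 < e / 2 by rewrite divr_gt0.
  have ws1 : 0 < w s + 1 by rewrite ltr_wpDl ?weight_ge0.
  have [_ /cvg_rnormP/(_ (e / 2 / (w s + 1)))] := g_lim s.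
  rewrite divr_gt0// => /(_ isT) Fs.
  (* dividing by w s + 1 rather than w s avoids a case split on w s = 0 *)
  near=> f.
  rewrite /wsum big_fsetU1//= [e]splitr ltrD//; last by near: f; exact: IH.
  rewrite (@le_lt_trans _ _ (rnorm (g s - f s) * (w s + 1)))//.
    by rewrite ler_wpM2l ?rnorm_ge0// lerDl.
  by rewrite -ltr_pdivlMr//; near: f; exact: Fs.
have tail_le (f : l1 w) (e : R) : F [set h | rnorm (f - h) < e] ->
    forall D, wsum w (g - l1_fun f) D <= e.
  move=> Ff D; apply/ler_addgt0Pr => d d0.
  have [h [fh gh]] := filter_ex (filterI Ff (wsum_cvg D d d0)).
  rewrite (le_trans (ler_wsumB w _ _ h _))// addrC lerD//; last exact: ltW.
  rewrite -opprB -scaleN1r wsumZ rnormN rnorm1 mul1r.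
  exact: le_trans (ler_wsum_l1norm (f - h) D) (ltW fh).
have gP : g \in l1_pred w.
  have [f Ff] := Fc 1 ltr01.
  rewrite -[g](subrK (l1_fun f)) rpredD//; last exact: l1_funP.
  apply/asboolP; split; last by exists 1; exact: tail_le.
  by move=> s ws0; rewrite !fctE (g_lim s).1// l1_eq0// subr0.
exists (L1 gP); apply/cvg_rnormP => e e0.
have e3 : 0 < e / 3 by rewrite divr_gt0.
have [f Ff] := Fc _ e3.
apply: filterS (Ff) => h /= fh.
rewrite (le_lt_trans (ler_rnormB _ _ f))// (@le_lt_trans _ _ (e / 3 + e / 3))//.
  by rewrite lerD// ?(ltW fh)// rnorm_l1 l1norm_le// => D; exact: tail_le.
by rewrite -mulrDl ltr_pdivrMr// -mulr2n -[e *+ 2]mulr_natr ltr_pM2l// ltr_nat.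
Unshelve. all: by end_near. Qed.

HB.instance Definition _ := Uniform_isComplete.Build (l1 w) l1_complete.

End l1_norm.

(** * The universal property of weighted l^1 spaces *)

Section unit_masses.
Variables (R : realType) (S : choiceType) (w : weight R S).
Implicit Types (f g : l1 w) (D E : {fset S}) (s t : S).

(** The unit mass at an index of weight zero is 0, as every element of [l1 w]
    vanishes there; then [mass s] has norm [w s] for all [s]. *)
Definition mass_fun s : S -> R[i] := fun t => ((t == s) && (w s != 0))%:R.

Lemma wsum_mass_fun s D : wsum w (mass_fun s) D <= w s.
Proof.
have mass0 t : t != s -> rnorm (mass_fun s t) * w t = 0.
  by move=> /negbTE ts; rewrite /mass_fun ts rnorm0 mul0r.
have mass1 : rnorm (mass_fun s s) * w s = w s.
  rewrite /mass_fun eqxx/=; have [->|_] := eqVneq (w s) 0.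
    by rewrite mulr0.
  by rewrite rnorm1 mul1r.
have [sD|sD] := boolP (s \in D).
  rewrite /wsum (big_fsetD1 s)//= mass1 big_seq big1 ?addr0// => t.
  by rewrite !inE => /andP[/mass0].
rewrite /wsum big_seq big1 ?weight_ge0// => t tD.
by apply: mass0; apply: contraNneq sD => <-.
Qed.

Lemma mass_funP s : mass_fun s \in l1_pred w.
Proof.
apply/asboolP; split; last by exists (w s) => D; exact: wsum_mass_fun.
move=> t wt; rewrite /mass_fun; case: (eqVneq t s) => //= <-.
by rewrite wt eqxx.
Qed.

Definition mass s : l1 w := L1 (mass_funP s).

Lemma rnorm_mass s : rnorm (mass s) = w s.
Proof.
rewrite rnorm_l1; apply/eqP; rewrite eq_le l1norm_le/=; last first.
  exact: wsum_mass_fun.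
rewrite (le_trans _ (ler_coef_l1norm _ s))//= /mass_fun eqxx/=.
have [->|_] := eqVneq (w s) 0; first by rewrite mulr0.
by rewrite rnorm1 mul1r.
Qed.

Lemma truncationE f D s :
  (\sum_(t <- D) f t *: mass t) s = if s \in D then f s else 0.
Proof.
have -> : (\sum_(t <- D) f t *: mass t) s = \sum_(t <- D) (f t *: mass t) s.
  by elim/big_rec2: _ => //= t x y _ <-.
have mass0 t : t != s -> (f t *: mass t) s = 0.
  move=> /negbTE ts; have -> : (f t *: mass t) s = f t * mass_fun t s by [].
  by rewrite /mass_fun [s == t]eq_sym ts mulr0.
have mass1 : (f s *: mass s) s = f s.
  have -> : (f s *: mass s) s = f s * mass_fun s s by [].
  rewrite /mass_fun eqxx/=.
  have [ws|_] := eqVneq (w s) 0; last by rewrite mulr1.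
  by rewrite (l1_eq0 f ws) mul0r.
case: ifPn => sD.
  rewrite (big_fsetD1 s)// mass1 big_seq big1 => [|t]; first exact: addr0.
  by rewrite !inE => /andP[/mass0].
rewrite big_seq big1// => t tD.
by apply: mass0; apply: contraNneq sD => <-.
Qed.

(** Off [D] the coefficients are those of [f], on [D] they are 0, and any finite
    sum of [|f_s| w_s] off [D] adds up with [wsum w f D] to at most the norm
    of [f].  Thus finite combinations of unit masses are dense. *)
Lemma l1norm_truncation f D :
  l1norm (f - \sum_(t <- D) f t *: mass t) <= l1norm f - wsum w f D.
Proof.
set h := f - _; apply: l1norm_le => E.
have h0 s : h s = if s \in D then 0 else f s.
  have -> : h s = f s - (\sum_(t <- D) f t *: mass t) s by [].
  by rewrite truncationE; case: ifP; rewrite ?subrr ?subr0.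
clearbody h; have DDE := fsubsetUl D E.
rewrite (le_trans (wsum_subset w h (fsubsetUr D E)))// lerBrDl.
rewrite (le_trans _ (ler_wsum_l1norm f (D `|` E)%fset))//.
rewrite /wsum [in leRHS](big_fset_split _ DDE)/= lerD2l.
rewrite (big_fset_split _ DDE)/= [X in X + _]big_seq big1 ?add0r; last first.
  by move=> s sD; rewrite h0 sD rnorm0 mul0r.
rewrite big_seq [leRHS]big_seq; apply: ler_sum => s.
by rewrite inE h0 => /andP[/negbTE -> _].
Qed.

End unit_masses.

Definition bdlinear (R : realType) (U V : normedModType R[i]) (T : U -> V) :=
  linear T /\ exists2 C : R, 0 <= C & forall x, rnorm (T x) <= C * rnorm x.

Lemma bdlinear_comp (R : realType) (U V W : normedModType R[i])
    (T2 : V -> W) (T1 : U -> V) :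
  bdlinear T2 -> bdlinear T1 -> bdlinear (T2 \o T1).
Proof.
move=> [T2l [C2 C2_ge0 T2C]] [T1l [C1 C1_ge0 T1C]].
split=> [k x y|]; first by rewrite /= T1l T2l.
exists (C2 * C1); first exact: mulr_ge0.
by move=> x; rewrite (le_trans (T2C _))// -mulrA ler_wpM2l.
Qed.

Section linear_extension.
Variables (R : realType) (S : choiceType) (w : weight R S).
Implicit Types (f g : l1 w) (D E : {fset S}) (s t : S).

Definition psum (V : normedModType R[i]) (v : S -> V) f D : V :=
  \sum_(s <- D) f s *: v s.

(** A bounded linear map commutes with the limit of truncations, so it is
    the sum of its values on unit masses. *)
Lemma cvg_psum_bounded_linear (V : normedModType R[i]) (T : {linear l1 w -> V})
    (C : R) : (forall f, rnorm (T f) <= C * rnorm f) ->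
  forall f, psum (T \o @mass _ _ w) f @ totally --> T f.
Proof.
move=> T_le f; apply/cvg_rnormP => e e0.
have C1 : 0 < `|C| + 1 by rewrite ltr_wpDl.
have [D fD] := wsum_l1norm_approx f (divr_gt0 e0 C1).
exists D => // E /= DE.
have -> : T f - psum (T \o @mass _ _ w) f E =
    T (f - \sum_(t <- E) f t *: mass w t).
  rewrite [RHS]linearB/= [in RHS]linear_sum/=; congr (_ - _).
  by apply: eq_bigr => s _; rewrite linearZ.
rewrite (le_lt_trans (T_le _))//.
rewrite (@le_lt_trans _ _ ((`|C| + 1) * (l1norm f - wsum w f E)))//.
  rewrite rnorm_l1.
  apply: le_trans (ler_wpM2l (ltW C1) (l1norm_truncation f E)).
  by rewrite ler_wpM2r ?l1norm_ge0// (le_trans (ler_norm C))// lerDl.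
rewrite mulrC -ltr_pdivlMr// ltrBlDr -ltrBlDl (lt_le_trans fD)//.
exact: wsum_subset.
Qed.

Section extension.
Variables (V : completeNormedModType R[i]) (v : S -> V).

(** The sum of the vectors [f s *: v s], as the limit of finite partial sums
    along the inclusion of finite sets of indices. *)
Definition ext f : V := lim (psum v f @ totally).

Variable C : R.
Hypothesis C_ge0 : 0 <= C.
Hypothesis v_le : forall s, rnorm (v s) <= C * w s.

Lemma ler_psum f D : rnorm (psum v f D) <= C * wsum w f D.
Proof.
rewrite (le_trans (ler_rnorm_sum _ _))// mulr_sumr ler_sum// => s _.
by rewrite rnormZ mulrCA ler_wpM2l ?rnorm_ge0.
Qed.

(** Absolute convergence: the sums of [|f_s| w_s] over finite sets disjoint
    from a large enough [D] are arbitrarily small. *)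
Lemma ext_cvg f : psum v f @ totally --> ext f.
Proof.
apply: cauchy_cvg; apply/cauchy_rnormP => e e0.
have C1 : 0 < C + 1 by rewrite ltr_wpDl.
have [D fD] := wsum_l1norm_approx f (divr_gt0 e0 C1).
exists (psum v f D), D => // E /= DE.
rewrite rnormB /psum (big_fset_split _ DE)/= addrAC subrr add0r.
rewrite (le_lt_trans (ler_psum _ _))//.
rewrite (@le_lt_trans _ _ ((C + 1) * wsum w f (E `\` D)%fset))//.
  by rewrite ler_wpM2r ?wsum_ge0// lerDl.
rewrite mulrC -ltr_pdivlMr//.
have := ler_wsum_l1norm f E; rewrite {1}/wsum (big_fset_split _ DE)/= => fE.
by rewrite -(ltrD2l (wsum w f D)) (le_lt_trans fE)// -ltrBlDr.
Qed.

Lemma ext_linear : linear ext.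
Proof.
move=> k f g; apply: cvg_lim => //.
have -> : psum v (k *: f + g) = (k \*: psum v f) \+ psum v g.
  apply/funext => D /=; rewrite /psum scaler_sumr -big_split/=.
  by apply: eq_bigr => s _; rewrite scalerDl scalerA.
by apply: cvgD; [apply: cvgZr; exact: ext_cvg|exact: ext_cvg].
Qed.

Lemma ler_rnorm_ext f : rnorm (ext f) <= C * rnorm f.
Proof.
have fcvg : psum v f @ totally --> ext f by exact: ext_cvg.
apply: (rnorm_limit_le fcvg); exists fset0 => // D _ /=.
by rewrite (le_trans (ler_psum f D))// rnorm_l1 ler_wpM2l// ler_wsum_l1norm.
Qed.

Lemma ext_bdlinear : bdlinear ext.
Proof. by split; [exact: ext_linear|exists C => //; exact: ler_rnorm_ext]. Qed.

Lemma ext_mass s : ext (mass w s) = v s.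
Proof.
apply: cvg_lim => //; apply/cvg_rnormP => e e0; exists [fset s]%fset => // D /=.
rewrite fsub1set => sD; rewrite /psum (big_fsetD1 s)//= big_seq big1.
  rewrite addr0 /mass_fun eqxx/=; have [ws|_] := eqVneq (w s) 0.
    have vs : v s = 0.
      apply/rnorm0_eq0/eqP; rewrite eq_le rnorm_ge0 andbT.
      by rewrite (le_trans (v_le s))// ws mulr0.
    by rewrite vs scaler0 subrr rnorm0.
  by rewrite scale1r subrr rnorm0.
by move=> t; rewrite !inE /mass_fun => /andP[/negbTE -> _]; rewrite /= scale0r.
Qed.

End extension.

(** Uniqueness in the universal property: an identity between bounded linear
    maps on [l1 w] only has to be checked on unit masses. *)
Lemma bdlinear_ext_eq (V : normedModType R[i]) (T1 T2 : l1 w -> V) :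
  bdlinear T1 -> bdlinear T2 ->
  (forall s, T1 (mass w s) = T2 (mass w s)) -> T1 =1 T2.
Proof.
move=> [T1l [C1 _ T1C]] [T2l [C2 _ T2C]] T12 f.
pose m1 := GRing.isLinear.Build _ _ _ _ T1 T1l.
pose m2 := GRing.isLinear.Build _ _ _ _ T2 T2l.
pose L1 : {linear l1 w -> V} := HB.pack T1 m1.
pose L2 : {linear l1 w -> V} := HB.pack T2 m2.
have c1 := @cvg_psum_bounded_linear V L1 _ T1C f.
have c2 := @cvg_psum_bounded_linear V L2 _ T2C f.
apply: cvg_unique c1 _ => //.
suff -> : L1 \o mass w = L2 \o mass w by [].
by apply/funext => s /=.
Qed.

End linear_extension.

(** * The convolution algebra of a submultiplicative weight *)

(** The exchange behind the linearity in [f] of the map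
    [f |-> a *: (f * g) + f * h], in any module. *)
Lemma lin_comb_swap (K : comPzRingType) (V : lmodType K) (a b : K)
    (x y z u : V) :
  a *: (b *: x + y) + (b *: z + u) = b *: (a *: x + z) + (a *: y + u).
Proof. by rewrite !scalerDr !scalerA [b * a]mulrC addrACA. Qed.

Record submul_weight (R : realType) (S : nmodType) := SubmulWeight {
  submul_weight_fun :> weight R S ;
  submul_weight0 : submul_weight_fun 0 = 1 ;
  submul_weightD : forall s t, submul_weight_fun (s + t) <=
                               submul_weight_fun s * submul_weight_fun t }.

Section convolution.
Variables (R : realType) (S : nmodType) (w : submul_weight R S).
Implicit Types (f g h : l1 w) (s t : S).

(** Convolution by the unit mass at [s]. *)
Definition translate s : l1 w -> l1 w := ext (fun t => mass w (s + t)).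

Let translate_bound s t : rnorm (mass w (s + t)) <= w s * w t.
Proof. by rewrite rnorm_mass submul_weightD. Qed.

Lemma translate_mass s t : translate s (mass w t) = mass w (s + t).
Proof. exact: (ext_mass (translate_bound s)). Qed.

Lemma translate_bdlinear s : bdlinear (translate s).
Proof. exact: (ext_bdlinear (weight_ge0 w s) (translate_bound s)). Qed.

(** The bilinear extension of [(s, t) |-> mass w (s + t)]. *)
Definition convolve f g : l1 w := ext (fun s => translate s g) f.

Let convolve_bound g s : rnorm (translate s g) <= rnorm g * w s.
Proof.
by rewrite mulrC (ler_rnorm_ext (weight_ge0 w s) (translate_bound s)).
Qed.

Lemma ler_rnorm_convolve f g : rnorm (convolve f g) <= rnorm f * rnorm g.
Proof.
by rewrite mulrC (ler_rnorm_ext (rnorm_ge0 g) (convolve_bound g)).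
Qed.

Lemma convolve_massl s g : convolve (mass w s) g = translate s g.
Proof. exact: (ext_mass (convolve_bound g)). Qed.

Lemma convolve_mass s t :
  convolve (mass w s) (mass w t) = mass w (s + t).
Proof. by rewrite convolve_massl translate_mass. Qed.

Lemma convolve_bdlinearl g : bdlinear (convolve^~ g).
Proof. exact: (ext_bdlinear (rnorm_ge0 g) (convolve_bound g)). Qed.

(** [convolve f] is not of the form [ext v], but for fixed [k], [g], [h] both
    sides of the linearity identity are bounded and linear in [f], and for [f] a
    unit mass they agree because translations are linear. *)
Lemma convolve_linearr f : linear (convolve f).
Proof.
move=> k g h.
apply: (bdlinear_ext_eq (T1 := convolve^~ (k *: g + h))
  (T2 := fun f => k *: convolve f g + convolve f h)).
- exact: convolve_bdlinearl.
- split=> [c f1 f2|].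
    rewrite (convolve_bdlinearl g).1 (convolve_bdlinearl h).1.
    exact: lin_comb_swap.
  exists (rnorm k * rnorm g + rnorm h).
    by rewrite addr_ge0 ?mulr_ge0 ?rnorm_ge0.
  move=> f1; rewrite (le_trans (ler_rnormD _ _))// mulrDl lerD//.
    by rewrite rnormZ -mulrA ler_wpM2l ?rnorm_ge0// mulrC ler_rnorm_convolve.
  by rewrite mulrC ler_rnorm_convolve.
- by move=> s; rewrite !convolve_massl (translate_bdlinear s).1.
Qed.

Lemma convolve_bdlinearr f : bdlinear (convolve f).
Proof.
split; first exact: convolve_linearr.
by exists (rnorm f); [exact: rnorm_ge0|exact: ler_rnorm_convolve].
Qed.

(** By bilinearity and boundedness the identity reduces, one variable at a time,
    to commutativity of the addition of indices; likewise for associativity and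
    for the unit. *)
Lemma convolveC : commutative convolve.
Proof.
move=> f g; apply: (bdlinear_ext_eq (convolve_bdlinearl g)
  (convolve_bdlinearr g)) => s.
apply: (bdlinear_ext_eq (convolve_bdlinearr (mass w s))
  (convolve_bdlinearl (mass w s))) => t.
by rewrite !convolve_mass addrC.
Qed.

Lemma convolveA : associative convolve.
Proof.
move=> f g h; apply: (bdlinear_ext_eq (convolve_bdlinearl (convolve g h))
  (bdlinear_comp (convolve_bdlinearl h) (convolve_bdlinearl g))) => s /=.
apply: (bdlinear_ext_eq
  (bdlinear_comp (convolve_bdlinearr (mass w s)) (convolve_bdlinearl h))
  (bdlinear_comp (convolve_bdlinearl h)
                 (convolve_bdlinearr (mass w s)))) => t /=.
apply: (bdlinear_ext_eq
  (bdlinear_comp (convolve_bdlinearr (mass w s))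
                 (convolve_bdlinearr (mass w t)))
  (convolve_bdlinearr _)) => u /=.
by rewrite !convolve_mass addrA.
Qed.

Lemma convolve1 : left_id (mass w 0) convolve.
Proof.
move=> g; apply: (bdlinear_ext_eq (convolve_bdlinearr (mass w 0))
  (T2 := id)) => [|s].
  by split=> //; exists 1 => // f; rewrite mul1r.
by rewrite convolve_mass add0r.
Qed.

Lemma convolveDl : left_distributive convolve +%R.
Proof.
move=> f g h; have := (convolve_bdlinearl h).1 1 f g.
by rewrite !scale1r.
Qed.

Lemma convolveZl (k : R[i]) f g :
  k *: convolve f g = convolve (k *: f) g.
Proof.
have l0 : convolve 0 g = 0.
  have := convolveDl 0 0 g; rewrite addr0 => /eqP.
  by rewrite -subr_eq0 opprD addrA subrr add0r oppr_eq0 => /eqP.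
have := (convolve_bdlinearl g).1 k f 0.
by rewrite l0 !addr0.
Qed.

Lemma norm_convolve f g : `|convolve f g| <= `|f| * `|g|.
Proof. by rewrite !normr_rnorm -rmorphM lecR ler_rnorm_convolve. Qed.

Lemma norm_mass0 : `|mass w 0| = 1.
Proof. by rewrite normr_rnorm rnorm_mass submul_weight0. Qed.

HB.instance Definition _ :=
  CompleteNormedModule_isComBanachAlgebra.Build R[i] (l1 w)
    convolveA convolveC convolve1 convolveDl convolveZl
    norm_convolve norm_mass0.

End convolution.

Section characters_of_l1.
Variables (R : realType) (S : nmodType) (w : submul_weight R S).
Local Notation A := (l1 w : comBanachAlgType R[i]).

Lemma massD s t : mass w (s + t) = (mass w s : A) * mass w t.
Proof. by rewrite -convolve_mass. Qed.

Lemma mass_exp s n : mass w (s *+ n) = (mass w s : A) ^+ n.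
Proof. by elim: n => [//|n IH]; rewrite mulrS massD IH exprS. Qed.

Lemma mass_sum (I : Type) (r : seq I) (F : I -> S) :
  mass w (\sum_(i <- r) F i) = \prod_(i <- r) (mass w (F i) : A).
Proof. by elim/big_rec2: _ => [//|i x y _ <-]; rewrite massD. Qed.

(** The functional is [ext chi].  It is multiplicative because
    [phi (f * g)] and [phi f * phi g] are bounded and linear in each of [f] and
    [g] and agree on unit masses. *)
Lemma exists_character (chi : S -> R[i]) :
  chi 0 = 1 -> {morph chi : s t / s + t >-> s * t} ->
  (forall s, rnorm (chi s) <= w s) ->
  exists2 phi : {scalar A}, @characters _ A phi &
    forall s, phi (mass w s) = chi s.
Proof.
move=> chi0 chiD chi_le.
have chi_le1 s : rnorm (chi s) <= 1 * w s by rewrite mul1r.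
have phi_bl := ext_bdlinear ler01 chi_le1.
have phi_mass := ext_mass chi_le1.
set phi := ext chi in phi_bl phi_mass.
have phiM : {morph phi : f g / (f : A) * (g : A) >-> f * g}.
  have mulbl (z : R[i]) : bdlinear (fun y : R[i] => z * y).
    split=> [k x y|]; first by rewrite mulrDr mulrCA.
    by exists (rnorm z) => [|x]; rewrite ?rnorm_ge0 ?rnormM.
  move=> f g; apply: (bdlinear_ext_eq
    (T1 := fun f => phi (convolve f g)) (T2 := fun f => phi f * phi g)).
  - exact: (bdlinear_comp phi_bl (convolve_bdlinearl g)).
  - have -> : (fun f => phi f * phi g) = (fun y => phi g * y) \o phi.
      by apply/funext => x; exact: (@mulrC R[i]).
    exact: (bdlinear_comp (mulbl _) phi_bl).
  move=> s; rewrite phi_mass; apply: (bdlinear_ext_eq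
    (T1 := fun g => phi (convolve (mass w s) g))
    (T2 := fun g => chi s * phi g)).
  - exact: (bdlinear_comp phi_bl (convolve_bdlinearr _)).
  - exact: (bdlinear_comp (mulbl _) phi_bl).
  by move=> t; rewrite convolve_mass !phi_mass chiD.
pose m := GRing.isLinear.Build R[i] A R[i]^o _ phi phi_bl.1.
pose Phi : {scalar A} := HB.pack phi m.
exists Phi => //; split; first exact: phiM.
by exists (mass w 0); rewrite /= phi_mass chi0 oner_neq0.
Qed.

End characters_of_l1.

(** * Characters of Banach algebras are contractive *)

Section contractive_characters.
Variables (R : realType) (A : comBanachAlgType R[i]).
Implicit Types x y z : A.

Lemma ler_rnormM x y : rnorm (x * y) <= rnorm x * rnorm y.
Proof. by have := banach_normM x y; rewrite !normr_rnorm -rmorphM lecR. Qed.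

Lemma ler_rnormX y n : rnorm (y ^+ n.+1) <= rnorm y ^+ n.+1.
Proof.
elim: n => [|n IH]; first by rewrite !expr1.
rewrite exprS [leRHS]exprS (le_trans (ler_rnormM _ _))//.
by rewrite ler_wpM2l// rnorm_ge0.
Qed.

(** The solution is the sum of the powers [y ^+ k] for [k >= 1]; equivalently,
    [1 + z] is the inverse of [1 - y]. *)
Lemma neumann_fixpoint y : rnorm y < 1 -> exists z, z = y + y * z.
Proof.
move=> y1; set q := rnorm y in y1; have q0 : 0 <= q by exact: rnorm_ge0.
have q1 : 0 < 1 - q by rewrite subr_gt0.
pose u n := \sum_(0 <= k < n) y ^+ k.+1.
have uS n : u n.+1 = y + y * u n.
  rewrite /u big_nat_recl//= expr1; congr (_ + _).
  by rewrite mulr_sumr; apply: eq_bigr => k _; rewrite exprS.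
(* the telescoped geometric bound, cleared of the denominator 1 - q *)
have u_dist m k : rnorm (u m - u (m + k)%N) * (1 - q) <= q ^+ m - q ^+ (m + k).
  elim: k => [|k IH]; first by rewrite addn0 !subrr rnorm0 mul0r.
  rewrite addnS.
  rewrite (le_trans (ler_wpM2r (ltW q1) (ler_rnormB _ _ (u (m + k)%N))))//.
  rewrite mulrDl -[q ^+ m](subrK (q ^+ (m + k))) -addrA lerD//.
  rewrite [u (m + k).+1]/u big_nat_recr//= opprD addrA subrr sub0r rnormN.
  rewrite [in leRHS]exprSr -[X in _ <= X - _]mulr1 -mulrBr.
  rewrite ler_wpM2r ?(ltW q1)//.
  rewrite (le_trans (ler_rnormX _ _))// exprSr -[leRHS]mulr1.
  by rewrite ler_wpM2l ?exprn_ge0// ltW.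
have /cvg_ex[z uz] : cvg (u @ \oo).
  apply: cauchy_cvg; apply/cauchy_rnormP => e e0.
  have : \forall n \near \oo, q ^+ n < e * (1 - q).
    have qn : (fun n => q ^+ n) @ \oo --> (0 : R).
      by apply: cvg_expr; rewrite ger0_norm.
    have /cvgrPdist_lt/(_ _ (mulr_gt0 e0 q1)) := qn.
    apply: filterS => n; rewrite sub0r normrN; exact: le_lt_trans (ler_norm _).
  move=> [N _ qN]; exists (u N), N => // n /= Nn.
  rewrite -(ltr_pM2r q1) -(subnKC Nn) (le_lt_trans (u_dist _ _))//.
  by rewrite (le_lt_trans _ (qN N _))//= gerDl oppr_le0 exprn_ge0.
exists z; apply/eqP; rewrite -subr_eq0; apply/eqP/rnorm0_eq0/eqP.
rewrite eq_le rnorm_ge0 andbT; apply/ler_addgt0Pr => e e0; rewrite add0r.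
have e2 : 0 < e / 2 by rewrite divr_gt0.
move/cvg_rnormP: uz => /(_ _ e2)[N _ uz].
have -> : z - (y + y * z) = (z - u N.+1) - y * (z - u N).
  by rewrite uS mulrBr opprB !opprD !addrA subrK.
rewrite (le_trans (ler_rnormD _ _))// rnormN [leRHS]splitr lerD//.
  by apply/ltW/uz => /=.
rewrite (le_trans (ler_rnormM _ _))// (@le_trans _ _ (1 * rnorm (z - u N)))//.
  by rewrite ler_wpM2r ?rnorm_ge0// ltW.
by rewrite mul1r; apply/ltW/uz => /=.
Qed.

(** If [|x| < |phi x|], put [y = x / phi x], so that [|y| < 1] and [phi y = 1].
    Applying [phi] to [z = y + y * z] gives [phi z = 1 + phi z], which is
    absurd. *)
Lemma character_contractive (phi : {scalar A}) :
  @characters _ A phi -> forall x, rnorm (phi x) <= rnorm x.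
Proof.
move=> [phiM _] x; rewrite leNgt; apply/negP => x_lt.
have c0 : phi x != 0.
  apply: contraTneq x_lt => ->.
  by rewrite rnorm0 -leNgt rnorm_ge0.
have c_gt0 : 0 < rnorm (phi x) by rewrite (le_lt_trans (rnorm_ge0 x)).
have [|z zE] := @neumann_fixpoint ((phi x)^-1 *: x).
  have : rnorm ((phi x)^-1 *: x) * rnorm (phi x) = rnorm x.
    by rewrite mulrC -rnormZ scalerA divff// scale1r.
  by move=> xE; rewrite -(ltr_pM2r c_gt0) xE mul1r.
have : phi z = 1 + phi z.
  rewrite {1}zE linearD/= phiM linearZ/=.
  have -> : (phi x)^-1 * phi x = 1 by exact: mulVf.
  by rewrite mul1r.
by move=> /eqP; rewrite -subr_eq0 opprD addrCA subrr addr0 oppr_eq0 oner_eq0.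
Qed.

End contractive_characters.

(** * Monomials and the joint spectrum *)

Section multi_indices.
Variable n : nat.
Implicit Types (i j : {ffun 'I_n -> nat}) (k : 'I_n).

Definition unit_index k : {ffun 'I_n -> nat} := [ffun l => (l == k) : nat].

Lemma multi_index_sum i : i = \sum_(k < n) unit_index k *+ i k.
Proof.
apply/ffunP => l; rewrite sum_ffunE (bigD1 l)//= big1 ?addr0 => [|k kl].
  by rewrite ffunMnE ffunE eqxx natn.
by rewrite ffunMnE ffunE eq_sym (negbTE kl) mul0rn.
Qed.

Definition monomial (K : comNzRingType) (x : 'I_n -> K) i : K :=
  \prod_(k < n) x k ^+ i k.

Lemma monomial0 (K : comNzRingType) (x : 'I_n -> K) : monomial x 0 = 1.
Proof. by rewrite /monomial big1// => k _; rewrite ffunE expr0. Qed.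

Lemma monomialD (K : comNzRingType) (x : 'I_n -> K) i j :
  monomial x (i + j) = monomial x i * monomial x j.
Proof.
by rewrite /monomial -big_split/=; apply: eq_bigr => k _; rewrite ffunE exprD.
Qed.

Lemma monomial_unit_index (K : comNzRingType) (x : 'I_n -> K) k :
  monomial x (unit_index k) = x k.
Proof.
rewrite /monomial (bigD1 k)//= big1 ?mulr1 => [|l lk].
  by rewrite ffunE eqxx expr1.
by rewrite ffunE (negbTE lk) expr0.
Qed.

End multi_indices.

Theorem theorem3p9 (R : realType) (n : nat) (n_ge1 : (1 <= n)%N)
    (a : {ffun 'I_n -> nat} -> R)
    (a_ge0 : forall i, 0 <= a i)
    (a_0 : a 0 = 1)
    (a_submul : forall i j, a (i + j) <= a i * a j) :
  exists (A : comBanachAlgType R[i]) (x : 'I_n -> A),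
    (forall i : {ffun 'I_n -> nat}, `|\prod_(k < n) x k ^+ i k| = (a i)%:C) /\
    joint_spectrum x =
      [set s : 'rV[R[i]]_n | forall i : {ffun 'I_n -> nat},
         `|\prod_(k < n) s ord0 k ^+ i k| <= (a i)%:C].
Proof.
pose w := @SubmulWeight R _ (Weight a_ge0) a_0 a_submul.
pose A : comBanachAlgType R[i] := l1 w.
pose x k : A := mass w (unit_index k).
have x_monomial (i : {ffun 'I_n -> nat}) :
    \prod_(k < n) x k ^+ i k = mass w i :> A.
  rewrite [in RHS](multi_index_sum i) mass_sum.
  by apply: eq_bigr => k _; rewrite mass_exp.
have x_norm (i : {ffun 'I_n -> nat}) :
    `|\prod_(k < n) x k ^+ i k : A| = (a i)%:C.
  by rewrite x_monomial normr_rnorm rnorm_mass.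
exists A, x; split=> //.
apply/seteqP; split=> [_ [phi phi_char <-] i|s s_le] /=.
  (* the point of the spectrum given by phi has monomials phi (x ^ i) *)
  have -> : \prod_(k < n) (\row_l phi (x l)) ord0 k ^+ i k =
      phi (\prod_(k < n) x k ^+ i k).
    have [phiM [y phi_y]] := phi_char.
    have phi1 : phi 1 = 1.
      by apply: (mulfI phi_y); rewrite -phiM !mulr1.
    have phiX y' m : phi (y' ^+ m) = phi y' ^+ m.
      by elim: m => [|m IH]; rewrite ?expr0// !exprS phiM IH.
    rewrite (big_morph phi phiM phi1); apply: eq_bigr => k _.
    by rewrite phiX mxE.
  rewrite normr_rnorm -x_norm normr_rnorm lecR.
  exact: character_contractive.
have [|||phi phi_char phi_mass] := @exists_character R _ w (monomial (s ord0)).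
- exact: monomial0.
- by move=> i j; exact: monomialD.
- by move=> i; rewrite -lecR -normr_rnorm; exact: s_le.
exists phi => //; apply/rowP => k.
by rewrite mxE phi_mass monomial_unit_index.
Qed.
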